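(* (1) For every $m\in\mathbb{N}$ and $s>0$, the matrix $A_m(s)$ is positive if and only if $$s\le s_m^{(p)}:=\frac{1}{\cosh\omega_m^{(p)}-1},$$ where $\omega_m^{(p)}\in\big(\log(2+\sqrt2),\,\log(2+\sqrt3)\big]$ is the unique positive root of the equation $$\coth(m\omega)\,\sinh\omega=3\cosh\omega-4 .$$ (2) The sequence $(s_m^{(p)})_{m\ge1}$ is strictly monotonically increasing, with all its terms in the interval $\big[1,\,2(2-\sqrt2)\big)$. As a consequence, the Crank-Nicolson method preserves positivity when the spatial mesh is refined keeping $s$ constant; that is, for fixed $s>0$, if $A_m(s)$ is positive and $m'\ge m$, then $A_{m'}(s)$ is positive.
   Context: $\mathbb{N}=\{1,2,3,\dots\}$. For $m\in\mathbb{N}$ and $s>0$ (the CFL coefficient $s=\tau/h^2$ with time step $\tau>0$ and mesh width $h=1/(m+1)$), the Crank-Nicolson iteration matrix for the heat equation $u_t=u_{xx}$ on $[0,1]$ with homogeneous Dirichlet boundary conditions is the $m\times m$ matrix $$A_m(s)=M_m(s)^{-1}N_m(s),$$ where $M_m(s)$ is the $m\times m$ tridiagonal matrix with diagonal entries $1+s$ and sub- and super-diagonal entries $-s/2$, and $N_m(s)$ is the $m\times m$ tridiagonal matrix with diagonal entries $1-s$ and sub- and super-diagonal entries $s/2$. A matrix is called positive if all of its entries are non-negative. *)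

(* Defs.v *)
From mathcomp Require Import all_boot all_order all_algebra.
From mathcomp Require Import classical_sets reals topology normedtype sequences.
From mathcomp Require Import exp.
From mathcomp Require Import lra.

Set Implicit Arguments.
Unset Strict Implicit.
Unset Printing Implicit Defensive.

Import Order.TTheory GRing.Theory Num.Theory.
Local Open Scope ring_scope.

Section Hyperbolic.
Variable R : realType.
Implicit Type x : R.

Definition sinh x : R := (expR x - expR (- x)) / 2.
Definition cosh x : R := (expR x + expR (- x)) / 2.
Definition coth x : R := cosh x / sinh x.

End Hyperbolic.

Section CrankNicolson.
Variable R : realType.
Implicit Types (m : nat) (s w : R).

Definition tridiag_mx m (d e : R) : 'M[R]_m :=
  \matrix_(i, j) if i == j then d
                 else if (i.+1 == j :> nat) || (j.+1 == i :> nat) then e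
                 else 0.

Definition CN_M m s : 'M[R]_m := tridiag_mx m (1 + s) (- (s / 2)).
Definition CN_N m s : 'M[R]_m := tridiag_mx m (1 - s) (s / 2).

(* [invmx] is a genuine inverse here when s > 0: see [CN_M_unit]. *)
Definition CN_A m s : 'M[R]_m := invmx (CN_M m s) *m CN_N m s.

Definition positive_mx m (A : 'M[R]_m) : Prop := forall i j, 0 <= A i j.

Definition omega_eq m w : Prop :=
  coth (m%:R * w) * sinh w = 3 * cosh w - 4.

(* The positive root, by classical choice: it denotes the root as soon as one
   exists and is unique. For m = 0, [coth 0] is 0 (division by zero) and the
   value has no meaning. *)
Definition omega_p m : R := xget 0 [set w : R | 0 < w /\ omega_eq m w]%classic.

Definition s_p m : R := 1 / (cosh (omega_p m) - 1).

Lemma CN_M_unit m s : 0 < s -> CN_M m s \in unitmx.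
Proof.
move=> s0; rewrite -row_free_unit -kermx_eq0.
apply/eqP/row_matrixP => i0; rewrite row0.
have : row i0 (kermx (CN_M m s)) *m CN_M m s = 0.
  by apply/sub_kermxP; rewrite row_sub.
move: (row i0 _) => u; case: m i0 u => [|m] i0 u uM; first by case: i0.
pose k := [arg max_(i > (ord0 : 'I_m.+1)) `|u 0 i|]%O.
have kmax j : `|u 0 j| <= `|u 0 k|.
  by rewrite /k; case: arg_maxP => // i _; exact.
have sgs (a : R) : 0 <= a -> 0 <= a * (s / 2) by move=> ?; apply: mulr_ge0 => //; lra.
have := congr1 (fun A : 'rV_m.+1 => A 0 k) uM; rewrite !mxE (bigD1 k) //= mxE eqxx.
set S := \sum_(_ | _) _ => /eqP; rewrite addr_eq0 => /eqP uk.
have S_le : `|S| <= s * `|u 0 k|.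
  pose P1 (i : 'I_m.+1) := (i.+1 == k :> nat); pose P2 (i : 'I_m.+1) := (k.+1 == i :> nat).
  have b1 (P : pred 'I_m.+1) : (forall i j, P i -> P j -> i = j) ->
      \sum_(i | P i) `|u 0 k| * (s / 2) <= `|u 0 k| * (s / 2).
    move=> Pu; case: (pickP P) => [i Pi|P0]; last by rewrite big_pred0 // sgs.
    rewrite (bigD1 i) //= big1 ?addr0 // => j /andP[Pj] /eqP[].
    exact: Pu.
  have -> : s * `|u 0 k| = `|u 0 k| * (s / 2) + `|u 0 k| * (s / 2) by lra.
  apply: le_trans (lerD (b1 P1 _) (b1 P2 _)); last 2 first.
  - by move=> i j /eqP + /eqP; move=> <- [] /esym/val_inj.
  - by move=> i j /eqP + /eqP; move=> -> /val_inj.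
  rewrite !(big_mkcond P1, big_mkcond P2) -big_split /=.
  apply: le_trans (ler_norm_sum _ _ _) _.
  rewrite big_mkcond; apply: ler_sum => i _; rewrite !mxE.
  have a0 := sgs _ (normr_ge0 (u 0 k)).
  case: ifP => [/negPf->|_]; last by apply: addr_ge0; case: ifP.
  have b0 : `|u 0 i * - (s / 2)| <= `|u 0 k| * (s / 2).
    rewrite mulrN normrN normrM (@ger0_norm _ (s / 2)); last lra.
    by apply: ler_wpM2r (kmax i); lra.
  rewrite -/(P1 i) -/(P2 i); case: (P1 i); case: (P2 i) => /=;
    rewrite ?mulr0 ?normr0 ?addr0 ?add0r //; lra.
have uk0 : `|u 0 k| = 0.
  have := congr1 Num.norm uk; rewrite normrN normrM (@gtr0_norm _ (1 + s)); last lra.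
  move=> e; have := normr_ge0 (u 0 k); move: S_le; rewrite -e; lra.
apply/rowP => j; rewrite [RHS]mxE; apply/eqP; rewrite -normr_le0 -uk0.
exact: kmax.
Qed.

End CrankNicolson.

(* Main.v *)
Require Import Defs.
From mathcomp Require Import all_boot all_order all_algebra.
From mathcomp Require Import classical_sets reals exp.
From mathcomp Require Import sequences ring lra zify.

Import Order.TTheory GRing.Theory Num.Theory.
Local Open Scope ring_scope.

(** Writing [t = expR w > 1] turns every hyperbolic quantity into a rational
    function of [t], and the theorem into an elementary study of one of them.

    Since N = 2 I - M, the iteration matrix is A = 2 M^-1 - I.  The M-matrix M
    has a nonnegative inverse, so only the diagonal entries of A can be
    negative.  The substitution s = 2 t / (t - 1)^2 ([cfl]), that is
    1 / s = cosh w - 1, is a decreasing bijection from t > 1 onto s > 0, and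
    makes M equal to s / 2 times the discrete operator
    b |-> (t + 1/t) b_k - b_(k-1) - b_(k+1), whose solutions are the
    combinations of t^k and t^-k.  Hence M^-1 is a multiple of the Green matrix
    [green] built from u_k = t^k - t^-k = 2 sinh (k w) ([CN_A_green]).  Its
    diagonal entries are multiples of u_i u_(m+1-i), smallest at the corners
    ([powdiff_corner]), so positivity of A amounts to the single inequality
    s u_(m+1) <= 4 u_m.

    With u_m = t^-m (t^2 - 1) (1 + t^2 + ... + t^(2 (m-1))) this inequality
    becomes 1 <= crit m t ([corner_entry_crit], [positive_CN_A]), where
    crit m t = (t^2 - 4 t + 2) (1 + t^2 + ... + t^(2 (m-1))), and the equation
    coth (m w) sinh w = 3 cosh w - 4 becomes crit m t = 1 ([omega_eq_crit]).
    On ]1, 2 + sqrt 2] the quadratic factor, hence [crit], is nonpositive; beyond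
    2 + sqrt 2 both factors are positive and [crit] increases in [t] as well as
    in [m]; at 2 + sqrt 3 the quadratic factor equals 1, so that crit >= 1.  The
    equation thus has a single root t_m, located in ]2 + sqrt 2, 2 + sqrt 3]
    and strictly decreasing in [m], and 1 <= crit m t means t_m <= t.
    Transporting this by the decreasing map [cfl], whose values at 2 + sqrt 3
    and 2 + sqrt 2 are 1 and 2 (2 - sqrt 2), gives everything. *)

Definition powdiff {R : fieldType} (t : R) (k : nat) : R := t ^+ k - t ^- k.

(** The sum is (t^(2 m) - 1) / (t^2 - 1); in this form the dependence on [m] and
    the positivity are visible, and the whole is a polynomial in [t]. *)
Definition crit {R : realFieldType} (m : nat) (t : R) : R :=
  (t ^+ 2 - 4 * t + 2) * \sum_(k < m) (t ^+ 2) ^+ k.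

(** This is 1 / (cosh w - 1) at [t = expR w]. *)
Definition cfl {R : realFieldType} (t : R) : R := 2 * t / (t - 1) ^+ 2.

(** * The sequence t^k - t^-k *)

Section PowerDifferences.
Variables (R : realFieldType) (t : R).
Hypothesis t_gt1 : 1 < t.
Let t_neq0 : t != 0. Proof. by rewrite gt_eqF // (lt_trans ltr01). Qed.

Lemma powdiff0 : powdiff t 0 = 0.
Proof. by rewrite /powdiff !expr0 invr1 subrr. Qed.

Lemma powdiff_gt0 k : 0 < powdiff t k.+1.
Proof.
have tk : 1 < t ^+ k.+1 by rewrite exprn_egt1.
rewrite subr_gt0 (lt_trans _ tk) // invf_lt1 // (lt_trans ltr01) //.
Qed.

Lemma powdiff_ge0 k : 0 <= powdiff t k.
Proof. by case: k => [|k]; rewrite ?powdiff0 // ltW ?powdiff_gt0. Qed.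

Lemma powdiff_rec k :
  powdiff t k.+2 = (t + t^-1) * powdiff t k.+1 - powdiff t k.
Proof. by rewrite /powdiff !exprS; field; rewrite t_neq0 expf_neq0. Qed.

(** The discrete Wronskian of the two solutions u_k and u_(n-k) of the recurrence
    is constant; it is the only nonzero value that the operator takes on a
    column of the Green matrix. *)
Lemma powdiff_docagne a b :
  powdiff t a.+2 * powdiff t b.+1 - powdiff t a.+1 * powdiff t b =
  powdiff t 1 * powdiff t (a + b).+2.
Proof. by rewrite /powdiff !exprS !exprD; field; rewrite t_neq0 !expf_neq0. Qed.

(** The difference of the two sides is u_a u_b.  Since (a + 1) + (b + 1) is fixed
    along the diagonal, the Green matrix has its smallest diagonal entries at the
    corners. *)
Lemma powdiff_corner a b :
  powdiff t 1 * powdiff t (a + b).+1 <= powdiff t a.+1 * powdiff t b.+1.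
Proof.
rewrite -subr_ge0.
suff -> : powdiff t a.+1 * powdiff t b.+1 - powdiff t 1 * powdiff t (a + b).+1
          = powdiff t a * powdiff t b by rewrite mulr_ge0 ?powdiff_ge0.
by rewrite /powdiff !exprS !exprD; field; rewrite t_neq0 !expf_neq0.
Qed.

Lemma powdiff_geometric k :
  powdiff t k = t ^- k * (t ^+ 2 - 1) * \sum_(i < k) (t ^+ 2) ^+ i.
Proof.
rewrite -mulrA -subrX1 -exprM mulnC exprM expr2 /powdiff.
by field; rewrite expf_neq0.
Qed.

(** The left-hand side says that a corner entry of A is nonnegative.  Both sides
    carry the factor t^-m (t^2 - 1) of [powdiff_geometric], and what remains is
    2 (t - 1)^2 S >= 1 + t^2 S, with S the geometric sum. *)
Lemma corner_entry_crit m :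
  (cfl t * powdiff t m.+1 <= 4 * powdiff t m) = (1 <= crit m t).
Proof.
rewrite /crit !powdiff_geometric.
have t0 : 0 < t by rewrite (lt_trans ltr01).
have c0 : 0 < 2 * t ^- m * (t ^+ 2 - 1) / (t - 1) ^+ 2.
  by rewrite !mulr_gt0 ?invr_gt0 ?exprn_gt0 ?subr_gt0 // exprn_egt1.
rewrite -[LHS]subr_ge0 -[RHS]subr_ge0 -[RHS](pmulr_rge0 _ c0); congr (0 <= _).
have -> : \sum_(k < m.+1) (t ^+ 2) ^+ k
          = 1 + t ^+ 2 * \sum_(k < m) (t ^+ 2) ^+ k.
  rewrite big_ord_recl /= expr0 mulr_sumr; congr (_ + _).
  by apply: eq_bigr => k _; rewrite -exprS.
rewrite /cfl; set S := \sum_(k < m) _; rewrite [t ^+ m.+1]exprS.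
field; rewrite t_neq0 expf_neq0 //= subr_eq0 gt_eqF //.
Qed.

End PowerDifferences.

(** * The change of variable s = 2 t / (t - 1)^2 *)

Section Cfl.
Variable R : rcfType.
Implicit Types s t : R.

Lemma cfl_gt0 t : 1 < t -> 0 < cfl t.
Proof.
move=> t1; rewrite /cfl divr_gt0 ?exprn_gt0 //; lra.
Qed.

Lemma cfl_decr t t' : 1 < t -> t < t' -> cfl t' < cfl t.
Proof.
move=> t1 tt'; rewrite /cfl ltr_pdivrMr ?exprn_gt0 //; last lra.
rewrite mulrAC ltr_pdivlMr ?exprn_gt0 //; last lra.
rewrite -subr_gt0.
suff -> : 2 * t * (t' - 1) ^+ 2 - 2 * t' * (t - 1) ^+ 2
        = 2 * (t' - t) * (t * t' - 1).
  have tt1 : 1 < t * t' by rewrite (lt_trans t1) // ltr_pMr; lra.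
  by rewrite !mulr_gt0 // subr_gt0.
ring.
Qed.

Lemma cfl_le t t' : 1 < t -> 1 < t' -> (cfl t <= cfl t') = (t' <= t).
Proof.
move=> t1 t'1; case: (ltgtP t t') => [tt'|t't|->]; last exact: lexx.
  by rewrite leNgt cfl_decr.
by rewrite ltW ?cfl_decr.
Qed.

Lemma cfl_surj s : 0 < s -> exists2 t, 1 < t & s = cfl t.
Proof.
move=> s0; set r := s^-1; have r0 : 0 < r by rewrite invr_gt0.
pose d := Num.sqrt (r ^+ 2 + 2 * r).
have dE : d ^+ 2 = r ^+ 2 + 2 * r by rewrite sqr_sqrtr //; nra.
have d0 : 0 <= d by exact: sqrtr_ge0.
exists (1 + r + d); first lra.
have -> : s = r^-1 by rewrite invrK.
rewrite /cfl; have -> : (1 + r + d - 1) ^+ 2 = r * (2 * (1 + r + d)) by nra.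
by field; apply/andP; split; lra.
Qed.

Lemma cfl_sqrt3 : cfl (2 + Num.sqrt 3 : R) = 1.
Proof.
have e : Num.sqrt 3 ^+ 2 = 3 :> R by rewrite sqr_sqrtr.
have d0 : 0 <= Num.sqrt 3 :> R by exact: sqrtr_ge0.
rewrite /cfl; have -> : (2 + Num.sqrt 3 - 1) ^+ 2 = 2 * (2 + Num.sqrt 3) :> R by lra.
by rewrite divff //; lra.
Qed.

Lemma cfl_sqrt2 : cfl (2 + Num.sqrt 2 : R) = 2 * (2 - Num.sqrt 2).
Proof.
have e : Num.sqrt 2 ^+ 2 = 2 :> R by rewrite sqr_sqrtr.
have d0 : 0 <= Num.sqrt 2 :> R by exact: sqrtr_ge0.
rewrite /cfl.
have -> : (2 + Num.sqrt 2 - 1) ^+ 2 = 3 + 2 * Num.sqrt 2 :> R by lra.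
have d1 : 3 + 2 * Num.sqrt 2 != 0 :> R by lra.
by apply: (mulIf d1); rewrite divfK //; lra.
Qed.
End Cfl.

(** * The inverse of the tridiagonal matrix and the corner criterion *)

Section TridiagonalInverse.
Variable R : realType.
Implicit Types (m : nat) (s t : R).

Lemma sum_delta m (k : nat) (f : nat -> R) :
  \sum_(j < m) (k == j :> nat)%:R * f j = if (k < m)%N then f k else 0.
Proof.
case: ifP => [km|km].
  rewrite (bigD1 (Ordinal km)) //= eqxx mul1r big1 ?addr0 // => j.
  by rewrite -val_eqE /= eq_sym => /negPf ->; rewrite mul0r.
rewrite big1 // => j _; case: eqP => [kj|_]; rewrite ?mul0r //.
by rewrite kj ltn_ord in km.
Qed.

(** Padding a vector by zeros at the indices [0] and [m.+1] removes the special
    case of the two boundary rows. *)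
Lemma tridiag_mx_sum m d e (b : nat -> R) (i : 'I_m) :
  b 0%N = 0 -> b m.+1 = 0 ->
  \sum_j tridiag_mx m d e i j * b j.+1 = d * b i.+1 + e * (b i + b i.+2).
Proof.
move=> b0 bm.
have entry (j : 'I_m) : tridiag_mx m d e i j * b j.+1
    = d * ((i == j :> nat)%:R * b j.+1)
      + e * ((i == j.+1 :> nat)%:R * b j.+1 + (i.+1 == j :> nat)%:R * b j.+1).
  rewrite mxE -val_eqE /= (eq_sym j.+1).
  have [ij|_] := eqVneq (i : nat) (j : nat).
    rewrite ij; have -> : (j == j.+1 :> nat) = false by lia.
    have -> : (j.+1 == j :> nat) = false by lia.
    rewrite /=; ring.
  have [ij|_] := eqVneq i.+1 (j : nat).
    have -> : (i == j.+1 :> nat) = false by lia.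
    rewrite /=; ring.
  by case: (_ == _); rewrite /=; ring.
rewrite (eq_bigr _ (fun j _ => entry j)) big_split /= -!mulr_sumr big_split /=.
rewrite (sum_delta m i (fun j => b j.+1)) (sum_delta m i.+1 (fun j => b j.+1)).
rewrite ltn_ord; congr (_ + _ * (_ + _)).
  case: i {entry} => [[|k] /= km]; first by rewrite big1 // => j _; rewrite mul0r.
  by rewrite (sum_delta m k (fun j => b j.+1)) ltnW.
case: ifP => // im; have -> : i.+2 = m.+1 by have := ltn_ord i; lia.
by rewrite bm.
Qed.

(** Column [j] of the Green matrix as a function of the index [k] in [0, m.+1]: the
    solution vanishing at [0] glued at [j.+1] to the one vanishing at [m.+1].
    Columns are counted from 0, and row [i] is at [k = i.+1]. *)
Definition green t m j k : R :=
  powdiff t (minn k j.+1) * powdiff t (m.+1 - maxn k j.+1).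

Lemma green_rec t m j i : 1 < t -> (i < m)%N -> (j < m)%N ->
  (t + t^-1) * green t m j i.+1 - (green t m j i + green t m j i.+2)
  = (i == j)%:R * (powdiff t 1 * powdiff t m.+1).
Proof.
move=> t1 im jm; rewrite /green.
(* [n.+1] is the distance from the index [i.+1] to the boundary index [m.+1]. *)
have [n mE] : exists n, m = (i + n).+1 by exists (m - i.+1)%N; lia.
case: (ltngtP i j) => ij.
- have -> : minn i j.+1 = i by lia.
  have -> : minn i.+1 j.+1 = i.+1 by lia.
  have -> : minn i.+2 j.+1 = i.+2 by lia.
  have -> : maxn i j.+1 = j.+1 by lia.
  have -> : maxn i.+1 j.+1 = j.+1 by lia.
  have -> : maxn i.+2 j.+1 = j.+1 by lia.
  by rewrite (powdiff_rec _ _ t1) /=; ring.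
- have -> : minn i j.+1 = j.+1 by lia.
  have -> : minn i.+1 j.+1 = j.+1 by lia.
  have -> : minn i.+2 j.+1 = j.+1 by lia.
  have -> : (m.+1 - maxn i j.+1 = n.+2)%N by lia.
  have -> : (m.+1 - maxn i.+1 j.+1 = n.+1)%N by lia.
  have -> : (m.+1 - maxn i.+2 j.+1 = n)%N by lia.
  by rewrite (powdiff_rec _ _ t1) /=; ring.
- rewrite -ij minnn.
  have -> : minn i i.+1 = i by lia.
  have -> : minn i.+2 i.+1 = i.+1 by lia.
  have -> : (m.+1 - maxn i i.+1 = n.+1)%N by lia.
  have -> : (m.+1 - maxn i.+1 i.+1 = n.+1)%N by lia.
  have -> : (m.+1 - maxn i.+2 i.+1 = n)%N by lia.
  rewrite mE -(powdiff_docagne _ _ t1) (powdiff_rec _ _ t1) /=; ring.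
Qed.

(** N = 2 I - M gives A = 2 M^-1 - I, and [green_rec] says that M times the Green
    matrix is the scalar (s / 2) u_1 u_(m+1). *)
Lemma CN_A_green t m (i j : 'I_m) : 1 < t ->
  CN_A m (cfl t) i j =
  4 / (cfl t * (powdiff t 1 * powdiff t m.+1)) * green t m j i.+1 - (i == j)%:R.
Proof.
move=> t1; set s := cfl t.
have s0 : 0 < s by exact: cfl_gt0.
set w := powdiff t 1 * powdiff t m.+1.
have w0 : 0 < w by rewrite mulr_gt0 ?powdiff_gt0.
have sE : 1 + s = s / 2 * (t + t^-1).
  by rewrite /s /cfl; field; apply/andP; split; lra.
pose G : 'M[R]_m := \matrix_(i, j) green t m j i.+1.
have MG : CN_M m s *m G = (s / 2 * w)%:M.
  apply/matrixP => a b; rewrite mxE [RHS]mxE /CN_M.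
  under eq_bigr do rewrite [G _ _]mxE.
  rewrite (tridiag_mx_sum m _ _ (green t m b)).
  - transitivity (s / 2 * ((t + t^-1) * green t m b a.+1
        - (green t m b a + green t m b a.+2))); first by rewrite sE; ring.
    by rewrite green_rec // -[RHS]mulr_natl mulrCA.
  - by rewrite /green min0n powdiff0 mul0r.
  - rewrite /green; have -> : (m.+1 - maxn m.+1 b.+1 = 0)%N by have := ltn_ord b; lia.
    by rewrite powdiff0 mulr0.
have NE : CN_N m s = CN_M m s *m ((4 / (s * w)) *: G - 1%:M).
  rewrite mulmxBr mulmx1 -scalemxAr MG scale_scalar_mx.
  have -> : 4 / (s * w) * (s / 2 * w) = 2 by field; rewrite !gt_eqF.
  apply/matrixP => a b; rewrite !mxE.
  by case: eqP => _; [|case: ifP => _]; rewrite /=; ring.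
by rewrite /CN_A NE mulKmx ?CN_M_unit // !mxE.
Qed.

(** Off the diagonal A is a multiple of the Green matrix, hence nonnegative; on it
    the smallest entry is the corner one. *)
Lemma positive_CN_A t m : (0 < m)%N -> 1 < t ->
  positive_mx (CN_A m (cfl t)) <-> 1 <= crit m t.
Proof.
case: m => // m _ t1; rewrite -corner_entry_crit //.
have s0 : 0 < cfl t by exact: cfl_gt0.
have u0 k : 0 < powdiff t k.+1 by exact: powdiff_gt0.
set c := 4 / (cfl t * (powdiff t 1 * powdiff t m.+2)).
have D0 := mulr_gt0 s0 (mulr_gt0 (u0 0%N) (u0 m.+1)).
have c0 : 0 < c by exact: divr_gt0.
have cornerE : (cfl t * powdiff t m.+2 <= 4 * powdiff t m.+1)
    = (1 <= c * (powdiff t 1 * powdiff t m.+1)).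
  rewrite /c -[RHS](ler_pM2l D0) mulr1.
  rewrite -[LHS](ler_pM2l (u0 0%N)); congr (_ <= _); first by ring.
  by field; rewrite !gt_eqF.
rewrite cornerE; split => [pos|corner i j].
  have := pos ord0 ord0; rewrite CN_A_green // subr_ge0 /green minnn maxnn.
  by rewrite subSS subn0.
rewrite CN_A_green //; have [<-|_] := eqVneq i j; last first.
  by rewrite subr0 (mulr_ge0 (ltW c0)) // /green mulr_ge0 ?powdiff_ge0.
rewrite subr_ge0 (le_trans corner) // ler_pM2l // /green minnn maxnn.
have im := ltn_ord i.
have -> : (m.+2 - i.+1 = (m - i).+1)%N by lia.
have {1}-> : m = (i + (m - i))%N by lia.
exact: powdiff_corner.
Qed.

End TridiagonalInverse.

(** * The roots of crit m t = 1 *)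

Section CriticalRoot.
Variable R : rcfType.
Implicit Types (m n : nat) (t : R).

Lemma sqrt2_bounds : [/\ 1 <= Num.sqrt 2 :> R, Num.sqrt 2 <= Num.sqrt 3 :> R
  & Num.sqrt 3 ^+ 2 = 3 :> R].
Proof.
by split; [rewrite -[leLHS]sqrtr1 ler_sqrt | rewrite ler_sqrt | rewrite sqr_sqrtr]; lra.
Qed.

Lemma quadratic_factor t : t ^+ 2 - 4 * t + 2
  = (t - (2 + Num.sqrt 2)) * (t - (2 - Num.sqrt 2)).
Proof.
have e : Num.sqrt 2 ^+ 2 = 2 :> R by rewrite sqr_sqrtr.
lra.
Qed.

Lemma geometric_ge1 m t : (0 < m)%N -> 1 <= \sum_(k < m) (t ^+ 2) ^+ k.
Proof.
case: m => // m _; rewrite big_ord_recl expr0 lerDl sumr_ge0 // => k _.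
by rewrite exprn_ge0 // sqr_ge0.
Qed.

Lemma crit_incr m t t' : (0 < m)%N -> 2 + Num.sqrt 2 <= t -> t < t' ->
  crit m t < crit m t'.
Proof.
have [s1 _ _] := sqrt2_bounds; move=> m0 t2 tt'; rewrite /crit.
have q0 : 0 <= t ^+ 2 - 4 * t + 2.
  by rewrite quadratic_factor mulr_ge0 //; lra.
have qq' : t ^+ 2 - 4 * t + 2 < t' ^+ 2 - 4 * t' + 2.
  rewrite -subr_gt0; have -> : t' ^+ 2 - 4 * t' + 2 - (t ^+ 2 - 4 * t + 2)
    = (t' - t) * (t' + t - 4) by ring.
  by rewrite mulr_gt0 //; lra.
have SS' : \sum_(k < m) (t ^+ 2) ^+ k <= \sum_(k < m) (t' ^+ 2) ^+ k.
  apply: ler_sum => k _; rewrite lerXn2r ?nnegrE ?sqr_ge0 //.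
  by rewrite lerXn2r ?nnegrE; lra.
apply: le_lt_trans (ler_wpM2l q0 SS') _.
by rewrite ltr_pM2r // (lt_le_trans ltr01) ?geometric_ge1.
Qed.

Lemma crit_le0 m t : 1 <= t -> t <= 2 + Num.sqrt 2 -> crit m t <= 0.
Proof.
have [s1 _ _] := sqrt2_bounds; move=> t1 t2; rewrite /crit mulr_le0_ge0 ?sumr_ge0 //.
  by rewrite quadratic_factor mulr_le0_ge0 //; lra.
by move=> k _; rewrite exprn_ge0 // sqr_ge0.
Qed.

Lemma crit_ltn m n t : 2 + Num.sqrt 2 < t -> (m < n)%N -> crit m t < crit n t.
Proof.
have [s1 _ _] := sqrt2_bounds; move=> t2; move: m n; apply: (homo_ltn lt_trans) => m.
rewrite /crit big_ord_recr /= mulrDr ltrDl mulr_gt0 ?exprn_gt0 //; last lra.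
by rewrite quadratic_factor mulr_gt0 //; lra.
Qed.

(** The intermediate value theorem for the polynomial crit - 1. *)
Lemma crit_root m : (0 < m)%N ->
  exists t : R, [/\ 2 + Num.sqrt 2 < t, t <= 2 + Num.sqrt 3 & crit m t = 1].
Proof.
move=> m0.
pose p : {poly R} := ('X ^+ 2 - 4 *: 'X + 2%:P) * (\sum_(k < m) ('X ^+ 2) ^+ k) - 1.
have pE t : p.[t] = crit m t - 1.
  rewrite /p /crit !hornerE horner_sum; congr (_ * _ - _).
  by apply: eq_bigr => k _; rewrite !hornerE.
have [s1 s23 e3] := sqrt2_bounds.
have le23 : 2 + Num.sqrt 2 <= 2 + Num.sqrt 3 :> R by rewrite lerD2l.
have [|t /andP[t2 t3] /rootP] := @poly_ivt R p _ _ le23.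
  rewrite !pE; apply/andP; split.
    have := @crit_le0 m (2 + Num.sqrt 2); lra.
  (* The quadratic factor is (t - 2)^2 - 2. *)
  have := geometric_ge1 m (2 + Num.sqrt 3) m0; rewrite /crit.
  have -> : (2 + Num.sqrt 3) ^+ 2 - 4 * (2 + Num.sqrt 3) + 2 = 1 :> R by lra.
  lra.
rewrite pE => ct; have {}ct : crit m t = 1 by lra.
exists t; split => //; rewrite ltNge; apply/negP => tle.
have := @crit_le0 m t; lra.
Qed.

End CriticalRoot.

(** * Back to the hyperbolic equation *)

Section Omega.
Variable R : realType.
Implicit Types (m n : nat) (w t : R).

(** With S the geometric sum, t^(2 m) = 1 + (t^2 - 1) S, and the two sides of the
    hyperbolic equation differ by (1 - crit m t) / (t S). *)
Lemma omega_eq_crit m w : (0 < m)%N -> 0 < w ->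
  omega_eq m w <-> crit m (expR w) = 1.
Proof.
move=> m0 w0; rewrite /omega_eq /coth /sinh /cosh !expRN !expRM_natl.
have : 1 < expR w by rewrite expR_gt1.
set t := expR w => t1; have tn0 : t != 0 by lra.
rewrite /crit; set S := \sum_(k < m) _.
have Sge1 : 1 <= S by exact: geometric_ge1.
have tm : t ^+ m ^+ 2 = 1 + (t ^+ 2 - 1) * S by rewrite -subrX1 -!exprM mulnC; ring.
set x := t ^+ m in tm *.
have x1 : 1 < x by rewrite /x exprn_egt1 // -lt0n.
have t2 : 0 < t ^+ 2 - 1 by rewrite subr_gt0 exprn_egt1.
have d0 : (t ^+ 2 - 1) * S != 0 by rewrite mulf_neq0 //; lra.
have S0 : S != 0 by lra.
have cothE : (x + x^-1) / 2 / ((x - x^-1) / 2) = (x ^+ 2 + 1) / (x ^+ 2 - 1).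
  field; rewrite tm addrAC subrr add0r d0 /=; lra.
have gap : (x + x^-1) / 2 / ((x - x^-1) / 2) * ((t - t^-1) / 2)
    - (3 * ((t + t^-1) / 2) - 4) = (1 - (t ^+ 2 - 4 * t + 2) * S) / (t * S).
  by rewrite cothE tm; field; rewrite addrAC subrr add0r d0 S0 tn0.
split=> [e|e]; apply/eqP.
  move/eqP: gap; rewrite e subrr eq_sym mulf_eq0 invr_eq0 mulf_eq0.
  by rewrite (negPf tn0) (negPf S0) !orbF subr_eq0 eq_sym.
by rewrite -subr_eq0 gap e subrr mul0r.
Qed.

Lemma s_pE m : s_p R m = cfl (expR (omega_p R m)).
Proof.
rewrite /s_p /cosh /cfl expRN; set t := expR _.
have t0 : 0 < t by exact: expR_gt0.
have -> : (t + t^-1) / 2 - 1 = (t - 1) ^+ 2 / (2 * t) by field; lra.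
by rewrite invf_div mul1r.
Qed.

(** The choice in [omega_p] picks the root given by [crit_root]: roots lie beyond
    2 + sqrt 2 because [crit] is nonpositive before, and there [crit] is
    injective. *)
Lemma omega_pP m : (0 < m)%N ->
  [/\ 0 < omega_p R m, omega_eq m (omega_p R m)
    & forall w, 0 < w -> omega_eq m w -> w = omega_p R m].
Proof.
move=> m0; have [t [t2 t3 ct]] := crit_root R m m0.
have s0 := sqrtr_ge0 (2 : R).
pose W w := 0 < w /\ omega_eq m w.
have big w : W w -> 2 + Num.sqrt 2 < expR w.
  case=> w0 /omega_eq_crit -/(_ m0 w0) cw; rewrite ltNge; apply/negP => le2.
  have := @crit_le0 R m (expR w) _ le2; rewrite cw ltW ?expR_gt1 // => /(_ isT).
  lra.
have uniq w w' : W w -> W w' -> w = w'.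
  move=> Ww Ww'; apply: expR_inj; move: (big _ Ww) (big _ Ww').
  case: Ww Ww' => w0 /omega_eq_crit -/(_ m0 w0) cw.
  case=> w'0 /omega_eq_crit -/(_ m0 w'0) cw'.
  move=> /ltW b /ltW b'; case: (ltgtP (expR w) (expR w')) => // lt.
    by have := crit_incr R m _ _ m0 b lt; rewrite cw cw' ltxx.
  by have := crit_incr R m _ _ m0 b' lt; rewrite cw cw' ltxx.
have Wt : W (ln t).
  have t1 : 1 < t by lra.
  split; first by rewrite ln_gt0.
  by apply/omega_eq_crit; rewrite ?ln_gt0 // lnK // posrE; lra.
have WO : W (omega_p R m) by exact: (@xgetI _ 0 W _ Wt).
by case: (WO) => O0 Oeq; split=> // w w0 we; apply: uniq.
Qed.

Lemma expR_omega_p m : (0 < m)%N ->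
  [/\ 2 + Num.sqrt 2 < expR (omega_p R m), expR (omega_p R m) <= 2 + Num.sqrt 3
    & crit m (expR (omega_p R m)) = 1].
Proof.
move=> m0; have [w0 we wu] := omega_pP m m0.
have [t [t2 t3 ct]] := crit_root R m m0.
suff -> : expR (omega_p R m) = t by [].
have s0 := sqrtr_ge0 (2 : R).
have tpos : t \is Num.pos by rewrite posrE; lra.
have lt0 : 0 < ln t by rewrite ln_gt0; lra.
rewrite -(wu (ln t) lt0) ?lnK //.
by apply/omega_eq_crit; rewrite ?lnK.
Qed.

Lemma expR_omega_p_gt1 m : (0 < m)%N -> 1 < expR (omega_p R m).
Proof. by case/omega_pP => w0 _ _; rewrite expR_gt1. Qed.

Lemma crit_ge1 m t : (0 < m)%N -> 1 < t ->
  (1 <= crit m t) = (expR (omega_p R m) <= t).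
Proof.
move=> m0 t1; have [T2 _ TE] := expR_omega_p m m0; rewrite -TE.
set T := expR _ in T2 TE *.
have [Tt|tT|->] := ltgtP T t; last exact: lexx.
  exact: ltW (crit_incr R m T t m0 (ltW T2) Tt).
apply/negbTE; rewrite -ltNge; have [t2|t2] := leP t (2 + Num.sqrt 2).
  rewrite TE; have := crit_le0 R m t (ltW t1) t2; lra.
exact: crit_incr R m t T m0 (ltW t2) tT.
Qed.

Lemma positive_CN_A_s_p m s : (0 < m)%N -> 0 < s ->
  positive_mx (CN_A m s) <-> s <= s_p R m.
Proof.
move=> m0 s0; have [t t1 ->] := cfl_surj R s s0.
rewrite s_pE (cfl_le R t _ t1 (expR_omega_p_gt1 m m0)) -(crit_ge1 m t m0 t1).
exact: positive_CN_A.
Qed.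

(** Adding a term to the geometric sum raises [crit] above 1 at the previous root,
    so the root moves left. *)
Lemma s_p_incr m n : (0 < m)%N -> (m < n)%N -> s_p R m < s_p R n.
Proof.
move=> m0 mn; have n0 : (0 < n)%N by lia.
rewrite !s_pE; apply: cfl_decr; first exact: expR_omega_p_gt1.
have [T2 _ TE] := expR_omega_p m m0; have [_ _ TnE] := expR_omega_p n n0.
have := crit_ltn R m n _ T2 mn; rewrite TE => lt1.
rewrite lt_neqAle -(crit_ge1 n _ n0 (expR_omega_p_gt1 m m0)) (ltW lt1) andbT.
by apply/eqP => eT; rewrite -eT TnE ltxx in lt1.
Qed.

Lemma s_p_bounds m : (0 < m)%N -> 1 <= s_p R m /\ s_p R m < 2 * (2 - Num.sqrt 2).
Proof.
move=> m0; have [T2 T3 _] := expR_omega_p m m0.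
have s0 := sqrtr_ge0 (2 : R); have s3 := sqrtr_ge0 (3 : R).
have t2 : 1 < 2 + Num.sqrt 2 :> R by lra.
have t3 : 1 < 2 + Num.sqrt 3 :> R by lra.
have lo := cfl_le R _ _ t3 (expR_omega_p_gt1 m m0).
have hi := cfl_decr R _ _ t2 T2.
rewrite T3 cfl_sqrt3 in lo; rewrite cfl_sqrt2 in hi.
by rewrite s_pE; split; [rewrite lo | exact: hi].
Qed.

End Omega.

Theorem theorem1 (R : realType) :
  (forall m : nat, (1 <= m)%N ->
    [/\ omega_p R m \in `]ln (2 + Num.sqrt 2), ln (2 + Num.sqrt 3)],
        omega_eq m (omega_p R m),
        (forall w : R, 0 < w -> omega_eq m w -> w = omega_p R m)
      & forall s : R, 0 < s -> (positive_mx (CN_A m s) <-> s <= s_p R m)])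
  /\
  [/\ forall m n : nat, (1 <= m)%N -> (m < n)%N -> s_p R m < s_p R n,
      forall m : nat, (1 <= m)%N -> s_p R m \in `[1, 2 * (2 - Num.sqrt 2)[
    & forall (s : R) (m m' : nat), 0 < s -> (1 <= m)%N -> (m <= m')%N ->
        positive_mx (CN_A m s) -> positive_mx (CN_A m' s)].
Proof.
split=> [m m0|].
  have [w0 we wu] := omega_pP R m m0; have [T2 T3 _] := expR_omega_p R m m0.
  have s0 := sqrtr_ge0 (2 : R); have s3 := sqrtr_ge0 (3 : R).
  split; [|exact: we|exact: wu|by move=> s; exact: positive_CN_A_s_p].
  have p2 : (2 + Num.sqrt 2 : R) \is Num.pos by rewrite posrE; lra.
  have p3 : (2 + Num.sqrt 3 : R) \is Num.pos by rewrite posrE; lra.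
  rewrite in_itv /=; apply/andP; split.
    by rewrite -ltr_expR lnK.
  by rewrite -ler_expR lnK.
split=> [m n m0 mn|m m0|s m m' s0 m0 mm' posA].
- exact: s_p_incr.
- by rewrite in_itv /=; apply/andP; exact: s_p_bounds.
- have sm := (positive_CN_A_s_p R m s m0 s0).1 posA.
  apply/(positive_CN_A_s_p R m' s (leq_trans m0 mm') s0)/(le_trans sm).
  move: mm'; rewrite leq_eqVlt => /predU1P[->|mm'].
    exact: lexx.
  exact: ltW (s_p_incr R m m' m0 mm').
Qed.
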